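(* Let $k$ be a field, let $m\geq 3$ and $0\leq r\leq s\leq m-2$ be integers, and let $\mathfrak{G}_m=\mathfrak{G}_{m,r,s}$ be the sparse matrix defined in the context, with ground polynomial ring $R=R_{m,r,s}$. Let $S=k[y_{i,j}\mid 1\leq i,j\leq m]$ and let $$\mathfrak{F}_{m,r,s}:\mathbb{P}^{m^2-\mathfrak{o}(r)-\mathfrak{o}(s)-1}=\mathrm{Proj}(R)\dashrightarrow\mathbb{P}^{m^2-1}=\mathrm{Proj}(S)$$ be the rational map whose $(i,j)$-coordinate is $\Delta(\mathfrak{G}_m)_{j,i}$. Then: (a) $\mathfrak{F}_{m,r,s}$ is a birational map onto its image. (b) Both $I_{m-r}(\mathfrak{L}_{m,r})$ and $I_{m-s}(\widetilde{\mathfrak{L}}_{m,s})$ are contained in the homogeneous defining ideal of the image of $\mathfrak{F}_{m,r,s}$.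
   Context: $\mathfrak{G}_{m,r,s}=(g_{i,j})$ is the $m\times m$ matrix with $g_{i,j}=x_{i,j}$ (independent indeterminates over $k$) if $r+2\leq i+j\leq 2m-s$, and $g_{i,j}=0$ otherwise; $R_{m,r,s}$ is the polynomial ring over $k$ in the nonzero entries of $\mathfrak{G}_{m,r,s}$. Put $\mathfrak{o}(u)=\binom{u+1}{2}$, so $\dim R_{m,r,s}=m^2-\mathfrak{o}(r)-\mathfrak{o}(s)$. $\Delta(\mathfrak{G}_m)_{j,i}$ denotes the signed $(i,j)$-cofactor of $\mathfrak{G}_m$ (complementary to row $i$ and column $j$). Let $\mathbf{Y}=(y_{i,j})_{1\leq i,j\leq m}$ be the generic matrix in the dual variables. For $r\geq 1$, the ladder $\mathfrak{L}_{m,r}$ consists of the entries $y_{i,j}$ of $\mathbf{Y}$ with $2\leq i,j\leq m$ and $i+j\geq r+3$. For $s\geq 1$, the ladder $\widetilde{\mathfrak{L}}_{m,s}$ consists of the entries $y_{i,j}$ with $1\leq i,j\leq m-1$ and $i+j\leq 2m-s-1$. $I_t$ of a ladder is the ideal of $S$ generated by the $t\times t$ minors of $\mathbf{Y}$ all of whose entries lie in the ladder. By convention $\mathfrak{L}_{m,0}=\widetilde{\mathfrak{L}}_{m,0}=\emptyset$ and $I_m(\emptyset)=0$. The homogeneous defining ideal of the image is the kernel of the $k$-algebra map $S\to R$ sending $y_{i,j}$ to the $(i,j)$-coordinate of the map. *)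

(* Defs.v *)
From mathcomp Require Import all_boot all_order all_algebra.
From mathcomp Require Export mpoly.

Set Implicit Arguments.
Unset Strict Implicit.
Unset Printing Implicit Defensive.

Import GRing.Theory.
Local Open Scope ring_scope.

(* Polynomial ring over k whose variables are indexed by a finite type I;
   I is numbered by enum_rank, with inverse enum_val. *)
Notation polyring k I := {mpoly k[#|I|]}.

Definition pvar (k : fieldType) (I : finType) (i : I) : polyring k I :=
  'X_(enum_rank i).

(* The k-algebra map polyring k J -> polyring k I sending pvar j to f j. *)
Definition psubst (k : fieldType) (I J : finType) (f : J -> polyring k I)
    (p : polyring k J) : polyring k I :=
  p \mPo [tuple f (enum_val l) | l < #|J|].

Definition ideal_gen (A : comNzRingType) (G : A -> Prop) (p : A) : Prop :=
  exists (n : nat) (c g : 'I_n -> A),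
    (forall i, G (g i)) /\ p = \sum_(i < n) c i * g i.

(** Rational maps between projective varieties, in homogeneous coordinates.
    An integral closed subvariety of Proj (polyring k I) is given by its
    homogeneous prime ideal P, seen as a predicate; the whole projective space
    is [zero_ideal].  A rational map from it to Proj (polyring k J) is
    represented by a J-tuple of forms of one common degree, not all in P. *)

Definition zero_ideal (A : nzRingType) (p : A) : Prop := p = 0.

Definition is_ratmap (k : fieldType) (I J : finType)
    (P : polyring k I -> Prop) (f : J -> polyring k I) : Prop :=
  (exists d : nat, forall j, f j \is d.-homog) /\ (exists j, ~ P (f j)).

(* Two representatives define the same rational map on V(P) iff they are
   proportional over the homogeneous coordinate ring, i.e. modulo P. *)
Definition same_ratmap (k : fieldType) (I J : finType)
    (P : polyring k I -> Prop) (f g : J -> polyring k I) : Prop :=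
  forall i j, P (f i * g j - f j * g i).

Definition comp_ratmap (k : fieldType) (I J L : finType)
    (g : L -> polyring k J) (f : J -> polyring k I) : L -> polyring k I :=
  fun l => psubst f (g l).

(* Homogeneous defining ideal of the (closed) image of a rational map defined
   on Proj (polyring k I). *)
Definition image_ideal (k : fieldType) (I J : finType)
    (f : J -> polyring k I) (p : polyring k J) : Prop := psubst f p = 0.

(* f is a rational map on Proj (polyring k I) and there is a rational map g
   from its image back to Proj (polyring k I) such that both composites are
   defined and are the identity as rational maps. *)
Definition birational_onto_image (k : fieldType) (I J : finType)
    (f : J -> polyring k I) : Prop :=
  is_ratmap (@zero_ideal _) f /\
  exists g : I -> polyring k J,
    [/\ is_ratmap (image_ideal f) g,
        is_ratmap (@zero_ideal _) (comp_ratmap g f),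
        same_ratmap (@zero_ideal _) (comp_ratmap g f) (@pvar k I),
        is_ratmap (image_ideal f) (comp_ratmap f g) &
        same_ratmap (image_ideal f) (comp_ratmap f g) (@pvar k J)].

(** The sparse generic matrix.  Rows and columns are 0-based in 'I_m, hence the
    successors: (i, j) : entry_index m stands for the position (i+1, j+1). *)

Definition entry_index (m : nat) : finType := ('I_m * 'I_m)%type.

Definition in_band (m r s : nat) (ij : entry_index m) : bool :=
  (r + 2 <= ij.1.+1 + ij.2.+1 <= 2 * m - s)%N.

Definition band (m r s : nat) : finType := {ij : entry_index m | in_band r s ij}.

Definition sparse_mx (k : fieldType) (m r s : nat) :
    'M[polyring k (band m r s)]_m :=
  \matrix_(i < m, j < m)
    (if insub ((i, j) : entry_index m) is Some u then pvar k (u : band m r s) else 0).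

Definition cofactor_map (k : fieldType) (m r s : nat) (ij : entry_index m) :
    polyring k (band m r s) :=
  cofactor (sparse_mx k m r s) ij.1 ij.2.

(** Ladders in the generic matrix in the dual variables. *)

Definition dual_mx (k : fieldType) (m : nat) :
    'M[polyring k (entry_index m)]_m :=
  \matrix_(i < m, j < m) pvar k ((i, j) : entry_index m).

Definition ladder (m r : nat) (i j : 'I_m) : bool :=
  [&& 0 < r, 2 <= i.+1, 2 <= j.+1 & r + 3 <= i.+1 + j.+1]%N.

Definition coladder (m s : nat) (i j : 'I_m) : bool :=
  [&& 0 < s, i.+1 <= m - 1, j.+1 <= m - 1 & i.+1 + j.+1 <= 2 * m - s - 1]%N.

Definition ladder_minor (k : fieldType) (m t : nat) (L : rel 'I_m)
    (p : polyring k (entry_index m)) : Prop :=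
  exists a b : 'I_t -> 'I_m,
    [/\ {homo a : i j / (i < j)%N}, {homo b : i j / (i < j)%N},
        forall i j, L (a i) (b j) &
        p = \det (mxsub a b (dual_mx k m))].

Definition ladder_ideal (k : fieldType) (m t : nat) (L : rel 'I_m) :
    polyring k (entry_index m) -> Prop :=
  ideal_gen (@ladder_minor k m t L).

(* Main.v *)
From HB Require Import structures.
Require Import Defs.
From mathcomp Require Import all_boot all_order all_algebra.
From mathcomp Require Import perm zify.

Set Implicit Arguments.
Unset Strict Implicit.
Unset Printing Implicit Defensive.

Import GRing.Theory.
Local Open Scope ring_scope.

(** Write G for the sparse matrix, D for its determinant and C for its matrix of
    cofactors, so that the map sends the dual matrix Y to C and C^T = adj G.
    Everything follows from G adj G = D, once D is known to be nonzero: the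
    band contains the antidiagonal, and setting the antidiagonal variables to
    1 and the others to 0 turns G into a permutation matrix.

    Birationality.  Taking cofactors twice multiplies G by D^(m-2)
    ([adj_adj]).  Hence the tuple g of the cofactors of Y at the band positions
    satisfies g(C) = D^(m-2) G entrywise: up to a common factor it is a left
    inverse of the map.  Such a left inverse is a two-sided one on the closure
    of the image ([birational_of_left_inverse]), because modulo the image ideal
    an identity in the dual variables may be tested after substituting C.

    Ladder minors.  Up to sign and a power of D, the minor of C on rows a and columns b
    is the complementary minor of G, which vanishes as soon as G has a zero
    block P x Q outside a and b that is too large for the size of that
    complementary minor.  The proof of [cofactor_minor_eq0] avoids the
    complementary minor: the zero block yields a combination of the
    columns of G indexed by Q that is nonzero and supported on the rows a, and
    the adjugate relation makes this a row relation of the minor of C.  A minor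
    inside the ladder (resp. coladder) leaves room, before its first row and
    column (resp. after its last ones), for such a block in the vanishing
    top left (resp. bottom right) corner of G, with #|P| + #|Q| equal to r + 1
    (resp. s + 1). *)

(** * Homogeneity of determinants *)

Section Homogeneous.
Variables (k : fieldType) (n : nat).

Lemma dhomog_prod_seq (I : Type) (s : seq I) (d : I -> nat)
    (F : I -> {mpoly k[n]}) :
  (forall i, F i \is (d i).-homog) ->
  \prod_(i <- s) F i \is (\sum_(i <- s) d i).-homog.
Proof.
move=> hF; elim/big_rec2: _ => [|i e p _ hp]; first exact: dhomog1.
exact: dhomogM.
Qed.

Lemma dhomog_det (q : nat) (M : 'M[{mpoly k[n]}]_q) (d : nat) :
  (forall i j, M i j \is d.-homog) -> \det M \is (q * d).-homog.
Proof.
move=> hM; apply: rpred_sum => s _; rewrite -signr_odd mulr_sign.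
suff h : \prod_i M i (s i) \is (q * d).-homog.
  by case: ifP => // _; rewrite dhomogN.
have := dhomog_prod_seq (index_enum 'I_q) (fun i => hM i (s i)).
by rewrite sum_nat_const card_ord.
Qed.

Lemma dhomog_cofactor (q : nat) (M : 'M[{mpoly k[n]}]_q) (d : nat) i j :
  (forall i j, M i j \is d.-homog) -> cofactor M i j \is (q.-1 * d).-homog.
Proof.
move=> hM; rewrite /cofactor -signr_odd mulr_sign.
suff h : \det (row' i (col' j M)) \is (q.-1 * d).-homog.
  by case: ifP => // _; rewrite dhomogN.
by apply: dhomog_det => i' j'; rewrite !mxE.
Qed.

End Homogeneous.

(** * Substitution and rational maps *)

Section Substitution.
Variable k : fieldType.

HB.instance Definition _ (I J : finType) (f : J -> polyring k I) :=
  GRing.RMorphism.copy (psubst f)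
    (comp_mpoly [tuple f (enum_val l) | l < #|J|]).

Lemma psubst_pvar (I J : finType) (f : J -> polyring k I) j :
  psubst f (pvar k j) = f j.
Proof. by rewrite /psubst comp_mpolyXU -tnth_nth tnth_mktuple enum_rankK. Qed.

Lemma psubstE (I J : finType) (f : J -> polyring k I) p :
  psubst f p =
  \sum_(u <- msupp p) p@_u *: \prod_(l < #|J|) f (enum_val l) ^+ u l.
Proof.
rewrite /psubst comp_mpolyE; apply: eq_bigr => u _; congr (_ *: _).
by apply: eq_bigr => l _; rewrite tnth_mktuple.
Qed.

Lemma psubst_id (I : finType) p : psubst (@pvar k I) p = p.
Proof.
rewrite psubstE [RHS]mpolyE; apply: eq_bigr => u _; congr (_ *: _).
by rewrite mpolyXE_id; apply: eq_bigr => l _; rewrite /pvar enum_valK.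
Qed.

Lemma psubst_comp (I J L : finType) (f : J -> polyring k I)
    (g : L -> polyring k J) p :
  psubst f (psubst g p) = psubst (fun l => psubst f (g l)) p.
Proof.
rewrite [psubst g p]psubstE [RHS]psubstE rmorph_sum; apply: eq_bigr => u _ /=.
rewrite {1}/psubst linearZ /= -/(psubst f _) rmorph_prod; congr (_ *: _).
by apply: eq_bigr => l _; rewrite rmorphXn.
Qed.

Lemma dhomog_psubst (I J : finType) (f : J -> polyring k I) d e p :
  (forall j, f j \is d.-homog) -> p \is e.-homog ->
  psubst f p \is (d * e).-homog.
Proof.
move=> hf /dhomogP hp; rewrite psubstE big_seq; apply: rpred_sum => u hu.
apply: dhomogZ; have := dhomog_prod_seq (index_enum _)
  (fun l : 'I_#|J| => dhomogMn (u l) (hf (enum_val l))).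
by rewrite -big_distrr /= -mdegE (hp _ hu).
Qed.

Lemma psubst_scale (I J : finType) (H : polyring k I)
    (f : J -> polyring k I) d p :
  p \is d.-homog -> psubst (fun j => H * f j) p = H ^+ d * psubst f p.
Proof.
move=> /dhomogP hp; rewrite !psubstE mulr_sumr big_seq [RHS]big_seq.
apply: eq_bigr => u hu; rewrite -scalerAr; congr (_ *: _).
under eq_bigr do rewrite exprMn.
by rewrite big_split /= prodrXr -mdegE (hp _ hu).
Qed.

Lemma pvar_neq0 (I : finType) (i : I) : pvar k i != 0.
Proof. by rewrite -msize_poly_eq0 msizeX. Qed.

(** For homogeneous f, the identity g(f) = H x gives f(g(f)) = f(H x) = H^d f,
    so f(g(y)) and y become proportional once f is substituted for y; that is
    exactly proportionality modulo the image ideal of f.  The points i0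
    and j0 are there to rule out composites that vanish identically. *)
Lemma birational_of_left_inverse (I J : finType) (f : J -> polyring k I)
    (g : I -> polyring k J) (H : polyring k I) d e (i0 : I) (j0 : J) :
  (forall j, f j \is d.-homog) -> (forall i, g i \is e.-homog) ->
  f j0 != 0 -> H != 0 -> (forall i, psubst f (g i) = H * pvar k i) ->
  birational_onto_image f.
Proof.
move=> hf hg f0 H0 gf.
have fg j : psubst f (comp_ratmap f g j) = H ^+ d * f j.
  rewrite /comp_ratmap psubst_comp -[in RHS](psubst_id (f j)).
  rewrite -(psubst_scale _ _ (hf j)) !psubstE.
  by apply: eq_bigr => u _; under eq_bigr do rewrite gf.
have Hx0 : H * pvar k i0 <> 0 by apply/eqP; rewrite mulf_neq0 ?pvar_neq0.
split; first by split; [exists d | exists j0; apply/eqP].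
exists g; split.
- by split; [exists e | exists i0; rewrite /image_ideal gf].
- split; first by exists (d * e)%N => i; apply: dhomog_psubst.
  by exists i0; rewrite /comp_ratmap gf.
- move=> i j; rewrite /comp_ratmap !gf /zero_ideal.
  by apply/eqP; rewrite subr_eq0 mulrAC.
- split; first by exists (e * d)%N => i; apply: dhomog_psubst.
  by exists j0; rewrite /image_ideal fg; apply/eqP; rewrite mulf_neq0 ?expf_neq0.
- move=> i j; rewrite /image_ideal rmorphB !rmorphM /= !fg !psubst_pvar.
  by apply/eqP; rewrite subr_eq0 mulrAC.
Qed.

End Substitution.

(** * Adjugate matrices over an integral domain *)

Section Adjugate.
Variable A : idomainType.

Lemma det_adj m (M : 'M[A]_m.+1) : \det M != 0 -> \det (\adj M) = \det M ^+ m.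
Proof.
move=> D0; apply: (mulfI D0).
by rewrite -det_mulmx mul_mx_adj det_scalar -exprS.
Qed.

(** Multiply adj M adj (adj M) = det (adj M) by M on the left and cancel
    det M. *)
Lemma adj_adj m (M : 'M[A]_m.+2) :
  \det M != 0 -> \adj (\adj M) = \det M ^+ m *: M.
Proof.
move=> D0; have : \det M *: \adj (\adj M) = \det M *: (\det M ^+ m *: M).
  rewrite -mul_scalar_mx -mul_mx_adj -mulmxA mul_mx_adj det_adj //.
  by rewrite mul_mx_scalar scalerA exprS.
move=> /matrixP eqD; apply/matrixP=> i j; apply: (mulfI D0).
by have := eqD i j; rewrite !mxE.
Qed.

(** Over a domain, a matrix with more rows than columns has dependent rows:
    padding it with zero columns to a square matrix makes its determinant
    vanish. *)
Lemma exists_linear_relation n q (M : 'M[A]_(n, q)) :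
  (q < n)%N -> exists2 v : 'rV[A]_n, v != 0 & v *m M = 0.
Proof.
move=> lt_qn; pose N : 'M[A]_n := \matrix_(i, j) oapp (M i) 0 (insub (j : nat)).
have detN0 : \det N == 0.
  rewrite (expand_det_col _ (Ordinal lt_qn)) big1 // => i _.
  by rewrite mxE /= insubN ?ltnn // mul0r.
have [v v0 vN] := det0P detN0; exists v => //.
apply/rowP=> j; rewrite [RHS]mxE.
move/rowP/(_ (widen_ord (ltnW lt_qn) j)): vN; rewrite [RHS]mxE => vN.
rewrite -[RHS]vN !mxE.
apply: eq_bigr => i _; rewrite !mxE /=.
by case: insubP => [j' _ /val_inj ->|]; rewrite ?ltn_ord.
Qed.

(** A form of the nullity theorem for a matrix and its inverse.  Look for a
    combination w of the columns of M indexed by Q whose entries vanish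
    outside the rows a.  On the rows P this is automatic, so that fewer than
    #|Q| linear conditions remain, and a nontrivial combination exists.  As
    det M != 0, w is nonzero; by the adjugate relation, pairing w with the
    column j of the cofactor matrix gives det M times the coefficient of the
    column j of M in w, which is 0 for j = b l' outside Q. *)
Lemma cofactor_minor_eq0 m t (M : 'M[A]_m) (a b : 'I_t -> 'I_m)
    (P Q : {set 'I_m}) :
  \det M != 0 -> injective a ->
  (forall l, a l \notin P) -> (forall l, b l \notin Q) ->
  {in P & Q, forall i j, M i j = 0} -> (m < t + #|P| + #|Q|)%N ->
  \det (\matrix_(l, l') cofactor M (a l) (b l')) = 0.
Proof.
move=> D0 inj_a aP bQ M0 ltm.
(* E indexes the conditions that remain to be imposed on w. *)
pose E := ~: (P :|: a @: setT).
have ltE : (#|E| < #|Q|)%N.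
  have : #|P :|: a @: setT| = (#|P| + t)%N.
    rewrite cardsU card_imset // cardsT card_ord (_ : _ :&: _ = set0).
      by rewrite cards0 subn0.
    apply/setP=> i; rewrite !inE; apply/andP=> -[iP /imsetP[l _ il]].
    by move: (aP l); rewrite -il iP.
  have := cardsC (P :|: a @: setT); rewrite card_ord -/E; lia.
pose f (x : 'I_#|Q|) := enum_val x.
have [u u0 uE] := exists_linear_relation
  (mxsub f (fun y : 'I_#|E| => enum_val y) M^T) ltE.
(* The coefficients u, extended by zero outside Q, form the row
   u *m rowsub f 1%:M. *)
pose w := u *m rowsub f M^T.
have w0 i : i \notin a @: setT -> w 0 i = 0.
  move=> ia; have [iP|iP] := boolP (i \in P).
    by rewrite mxE big1 // => x _; rewrite !mxE M0 ?mulr0 // enum_valP.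
  have iE : i \in E by rewrite !inE negb_or iP.
  move/rowP/(_ (enum_rank_in iE i)): uE; rewrite !mxE => h; rewrite -[RHS]h.
  by apply: eq_bigr => x _; rewrite !mxE enum_rankK_in.
have wadj : w *m (\adj M)^T = \det M *: (u *m rowsub f 1%:M).
  rewrite -mulmxA mul_rowsub_mx -trmx_mul mul_adj_mx tr_scalar_mx.
  rewrite scalemxAr; congr (_ *m _).
  by apply/matrixP=> x i; rewrite !mxE mulr_natr.
have wadjE j :
    \sum_i w 0 i * cofactor M i j = \det M * (u *m rowsub f 1%:M) 0 j.
  move/rowP/(_ j): wadj; rewrite [RHS]mxE mxE => <-.
  by apply: eq_bigr => i _; rewrite !mxE.
apply/eqP/det0P; exists (\row_l w 0 (a l)).
  apply: contra_neq u0 => wa0; apply/rowP=> x; apply: (mulfI D0).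
  have wE0 i : w 0 i = 0.
    have [/imsetP[l _ ->]|/w0//] := boolP (i \in a @: setT).
    by move/rowP/(_ l): wa0; rewrite !mxE.
  transitivity (\det M * (u *m rowsub f 1%:M) 0 (f x)).
    congr (_ * _); rewrite mxE (bigD1 x) //= big1 ?addr0 ?mxE ?eqxx ?mulr1 //.
    by move=> y yx; rewrite !mxE (inj_eq enum_val_inj) (negPf yx) mulr0.
  by rewrite -wadjE big1 ?mxE ?mulr0 // => i _; rewrite wE0 mul0r.
apply/rowP=> l; rewrite !mxE.
transitivity (\sum_i w 0 i * cofactor M i (b l)).
  rewrite [RHS](bigID (mem (a @: setT))) /= [X in _ + X]big1 ?addr0.
    rewrite big_imset /=; last by move=> ? ? _ _ /inj_a.
    by apply: eq_big => [l'|l' _]; rewrite ?inE // !mxE.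
  by move=> i /w0 ->; rewrite mul0r.
rewrite wadjE mxE big1 ?mulr0 // => x _.
rewrite !mxE; case: eqP => [xb|]; last by rewrite mulr0.
by move: (bQ l); rewrite -xb enum_valP.
Qed.

End Adjugate.

(** * Initial and final segments, increasing sequences of indices *)

Lemma card_ord_lt m p : (p <= m)%N -> #|[set i : 'I_m | (i < p)%N]| = p.
Proof.
move=> le_pm; rewrite cardsE -sum1_card -[RHS]card_ord -[RHS]sum1_card.
by rewrite -(big_ord_widen m (fun=> 1%N)).
Qed.

Lemma card_ord_ge m p : (p <= m)%N -> #|[set i : 'I_m | (m - p <= i)%N]| = p.
Proof.
move=> le_pm; rewrite -[RHS](card_ord_lt le_pm) -[RHS](card_imset _ rev_ord_inj).
apply: eq_card => i; rewrite inE; apply/idP/imsetP => [hi|[j + ->]].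
  by exists (rev_ord i); rewrite ?rev_ordK // inE /=; have := ltn_ord i; lia.
by rewrite inE /=; have := ltn_ord j; lia.
Qed.

Lemma increasing_inj t m (a : 'I_t -> 'I_m) :
  {homo a : i j / (i < j)%N} -> injective a.
Proof.
move=> inc_a x y axy; apply/val_inj/eqP.
by case: ltngtP => // /inc_a; rewrite axy ltnn.
Qed.

Lemma increasing_le t m (a : 'I_t -> 'I_m) :
  {homo a : i j / (i < j)%N} -> {homo a : i j / (i <= j)%N}.
Proof.
move=> inc_a x y; rewrite leq_eqVlt => /orP[/eqP/val_inj -> //|/inc_a].
exact: ltnW.
Qed.

(** * The sparse matrix and its cofactor map *)

Section SparseMatrix.
Variables (k : fieldType) (m r s : nat).
Notation G := (sparse_mx k m r s).

Lemma sparse_mx_eq0 i j : ~~ in_band r s (i, j) -> G i j = 0.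
Proof. by move=> ij; rewrite mxE insubN. Qed.

Lemma dhomog_sparse_mx i j : G i j \is 1.-homog.
Proof.
rewrite mxE; case: insubP => [u _ _|_]; last exact: dhomog0.
by rewrite dhomogX; apply/eqP/mdeg1.
Qed.

(** The two bounds say that the antidiagonal lies in the band. *)
Lemma det_sparse_mx_neq0 :
  (r + 2 <= m.+1)%N -> (m.+1 <= 2 * m - s)%N -> \det G != 0.
Proof.
move=> hr hs; pose v (l : 'I_#|band m r s|) : k :=
  (rev_ord (val (enum_val l)).1 == (val (enum_val l)).2)%:R.
apply/eqP=> /(congr1 (meval v)); apply/eqP.
have -> : (\det G).@[v] = \det (perm_mx (perm (@rev_ord_inj m)) : 'M[k]_m).
  rewrite -det_map_mx; congr (\det _); apply/matrixP=> i j; rewrite !mxE permE.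
  case: insubP => [u _ uE|nb]; first by rewrite [LHS]mevalXU /v enum_rankK uE.
  rewrite [LHS]meval0; case: eqP => // ij; case/negP: nb.
  by rewrite /in_band /= -ij /=; have := ltn_ord i; lia.
by rewrite meval0 det_perm signr_eq0.
Qed.

Lemma map_psubst_dual_mx :
  map_mx (psubst (@cofactor_map k m r s)) (dual_mx k m) = (\adj G)^T.
Proof. by apply/matrixP=> i j; rewrite !mxE psubst_pvar. Qed.

(** Membership in the image ideal is tested on generators, and the map turns a
    minor of the dual matrix into the same minor of the cofactor matrix. *)
Lemma image_ideal_ladder_ideal t (L : rel 'I_m) :
  (forall a b : 'I_t -> 'I_m, {homo a : i j / (i < j)%N} ->
     {homo b : i j / (i < j)%N} -> (forall i j, L (a i) (b j)) ->
     \det (\matrix_(l, l') cofactor G (a l) (b l')) = 0) ->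
  forall p, ladder_ideal (k := k) t L p -> image_ideal (@cofactor_map k m r s) p.
Proof.
move=> minor0 _ [n [c [g [hg ->]]]]; rewrite /image_ideal rmorph_sum.
rewrite big1 // => i _.
have [a [b [inc_a inc_b ab ->]]] := hg i.
rewrite rmorphM -det_map_mx map_mxsub map_psubst_dual_mx.
rewrite (_ : mxsub a b _ = \matrix_(l, l') cofactor G (a l) (b l')).
  by rewrite minor0 ?mulr0.
by apply/matrixP=> x y; rewrite !mxE.
Qed.

End SparseMatrix.

Theorem theorem3p3 (k : fieldType) (m r s : nat)
    (hm : (3 <= m)%N) (hrs : (r <= s)%N) (hs : (s <= m - 2)%N) :
  birational_onto_image (@cofactor_map k m r s) /\
  ((forall p, ladder_ideal (k := k) (m - r) (@ladder m r) p ->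
              image_ideal (@cofactor_map k m r s) p) /\
   (forall p, ladder_ideal (k := k) (m - s) (@coladder m s) p ->
              image_ideal (@cofactor_map k m r s) p)).
Proof.
have D0 : \det (sparse_mx k m r s) != 0 by apply: det_sparse_mx_neq0; lia.
split; last split.
- case: m hm hs D0 => [|[|n]] // hn hs' D0.
  pose G := sparse_mx k n.+2 r s.
  have i0 : band n.+2 r s.
    by exists (ord0, ord_max); rewrite /in_band /=; lia.
  have [j0 Gj0] : exists j, cofactor G ord0 j != 0.
    apply/existsP; apply: contra_neqT D0 => /existsPn nz.
    rewrite (expand_det_row _ ord0) big1 // => j _.
    by have := nz j; rewrite negbK => /eqP ->; rewrite mulr0.
  apply: (@birational_of_left_inverse k _ _ _
    (fun u : band n.+2 r s => cofactor (dual_mx k n.+2) (val u).1 (val u).2)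
    (\det G ^+ n) (n.+1 * 1)%N (n.+1 * 1)%N i0 (ord0, j0)) => //.
  + move=> ij; apply: dhomog_cofactor => i j; exact: dhomog_sparse_mx.
  + move=> u; apply: dhomog_cofactor => i j.
    by rewrite mxE dhomogX; apply/eqP/mdeg1.
  + by rewrite expf_neq0.
  move=> u; rewrite -cofactor_map_mx map_psubst_dual_mx cofactor_tr.
  have /matrixP/(_ (val u).1 (val u).2) := adj_adj D0.
  rewrite mxE => ->; rewrite !mxE; case: insubP => [u' _ /=|].
    by rewrite -surjective_pairing => /val_inj ->.
  by rewrite -surjective_pairing valP.
- apply: image_ideal_ladder_ideal => a b inc_a inc_b ab.
  have lt0 : (0 < m - r)%N by lia.
  pose l0 := Ordinal lt0.
  have [r0 a0 b0 ab0] := and4P (ab l0 l0).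
  (* Rows i < p and columns j < q with p + q = r + 1 form a zero block of G.
     It lies before the minor: p <= a l0 by choice; and q <= b l0 because
     a l0 + b l0 >= r + 1 when p = a l0, and because b l0 >= 1 = q when
     p = r. *)
  pose p := minn (a l0) r; pose q := (r.+1 - p)%N.
  have pE : (p + q = r.+1)%N by lia.
  have pa l : (p <= a l)%N.
    by have := increasing_le inc_a (leq0n l : l0 <= l)%N; lia.
  have qb l : (q <= b l)%N.
    by have := increasing_le inc_b (leq0n l : l0 <= l)%N; lia.
  apply: (@cofactor_minor_eq0 _ _ _ _ _ _ [set i : 'I_m | (i < p)%N]
            [set j : 'I_m | (j < q)%N]) => //.
  + exact: increasing_inj.
  + by move=> l; rewrite inE -leqNgt.
  + by move=> l; rewrite inE -leqNgt.
  + move=> i j; rewrite !inE => ip jq; apply: sparse_mx_eq0.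
    by rewrite /in_band /=; lia.
  by rewrite !card_ord_lt; lia.
- apply: image_ideal_ladder_ideal => a b inc_a inc_b ab.
  have lt0 : ((m - s).-1 < m - s)%N by lia.
  pose l1 := Ordinal lt0.
  have le_l1 (l : 'I_(m - s)) : (l <= l1)%N by have := ltn_ord l; rewrite /=; lia.
  have [s0 a1 b1 ab1] := and4P (ab l1 l1).
  (* The mirror image: the last p rows and q columns, with p + q = s + 1,
     come after the last row a l1 and the last column b l1. *)
  pose p := minn (m - (a l1).+1) s; pose q := (s.+1 - p)%N.
  have pE : (p + q = s.+1)%N by lia.
  have pa l : (a l < m - p)%N by have := increasing_le inc_a (le_l1 l); lia.
  have qb l : (b l < m - q)%N by have := increasing_le inc_b (le_l1 l); lia.
  apply: (@cofactor_minor_eq0 _ _ _ _ _ _ [set i : 'I_m | (m - p <= i)%N]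
            [set j : 'I_m | (m - q <= j)%N]) => //.
  + exact: increasing_inj.
  + by move=> l; rewrite inE -ltnNge.
  + by move=> l; rewrite inE -ltnNge.
  + move=> i j; rewrite !inE => ip jq; apply: sparse_mx_eq0.
    by rewrite /in_band /=; lia.
  by rewrite !card_ord_ge; lia.
Qed.
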